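(* Let $\Phi:\mathbb{D}\to\mathbb{R}^3$ be a conformal Willmore immersion. Let $\iota:x\mapsto\frac{x}{|x|^2}$ be the inversion at the origin, and let $V_{*,\iota}$ denote the conserved quantity $V_*$ (for $*\in\{\mathrm{tra},\mathrm{inv},\mathrm{dil}\}$), and $\tilde V_{\mathrm{rot},\iota}$ the quantity $\tilde V_{\mathrm{rot}}$, computed for $\iota\circ\Phi$ instead of $\Phi$. Then (at points where $\Phi\neq0$) $$V_{\mathrm{tra},\iota}=V_{\mathrm{inv}},\qquad V_{\mathrm{inv},\iota}=V_{\mathrm{tra}},\qquad V_{\mathrm{dil},\iota}=-V_{\mathrm{dil}},\qquad \tilde V_{\mathrm{rot},\iota}=\tilde V_{\mathrm{rot}} .$$
   Context: $\mathbb{D}$ is the unit disk with coordinates $(x,y)$, $z=x+iy$; $\nabla=(\partial_x,\partial_y)$, $\nabla^\perp=(-\partial_y,\partial_x)$. The quantities below are pairs (one component for each derivative), and all algebraic operations (products, cross products $\times$ in $\mathbb{R}^3$, scalar products) act componentwise on these pairs. For a smooth conformal immersion $\Phi$ into $\mathbb{R}^3$: $e^{2\lambda}=2\langle\Phi_z,\Phi_{\bar z}\rangle=|\Phi_x|^2$, $\vec n=e^{-2\lambda}\Phi_x\times\Phi_y$, $H=2e^{-2\lambda}\langle\Phi_{z\bar z},\vec n\rangle$, $\vec H=H\vec n$, $\Omega=2\langle\Phi_{zz},\vec n\rangle$. Writing $e^{-2\lambda}\langle\nabla^2\Phi,\vec n\rangle=\begin{pmatrix}\epsilon&\varphi\\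 \varphi&\gamma\end{pmatrix}$, set $\mathring A\nabla\Phi=\left(\frac{\epsilon-\gamma}{2}\Phi_x+\varphi\Phi_y,\ \varphi\Phi_x-\frac{\epsilon-\gamma}{2}\Phi_y\right)$. $\pi_{\vec n}$ is the orthogonal projection onto $\mathbb{R}\vec n$. $\Phi$ is Willmore if $H_{z\bar z}+\frac{|\Omega|^2e^{-2\lambda}}{2}H=0$. Conserved quantities: $$V_{\mathrm{tra}}=\nabla\vec H-3\pi_{\vec n}(\nabla\vec H)+\nabla^\perp\vec n\times\vec H,\qquad V_{\mathrm{dil}}=\langle V_{\mathrm{tra}},\Phi\rangle,\qquad V_{\mathrm{rot}}=\Phi\times V_{\mathrm{tra}}+2H\nabla^\perp\Phi,$$ $$V_{\mathrm{inv}}=|\Phi|^2V_{\mathrm{tra}}-2V_{\mathrm{dil}}\Phi+4\,\Phi\times(\vec n\times\mathring A\nabla\Phi),\qquad \tilde V_{\mathrm{rot}}=V_{\mathrm{rot}}+2\nabla^\perp\vec n .$$ For $\iota\circ\Phi$ all these objects (including the Gauss map) are defined by the same formulas in the same coordinates. *)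

(* Defs.v *)
From Stdlib Require Import Reals.
From Coquelicot Require Import Coquelicot.

Open Scope R_scope.

(** Vectors of R^3 and of C^3 are triples; the vector space operations on
    [R3], and the componentwise ones on pairs [R3 * R3], are Coquelicot's
    [plus], [minus], [opp], [scal], [zero]. *)

Definition R3 : Type := (R * R * R)%type.
Definition C3 : Type := (C * C * C)%type.

Definition p1 {A : Type} (v : A * A * A) : A := fst (fst v).
Definition p2 {A : Type} (v : A * A * A) : A := snd (fst v).
Definition p3 {A : Type} (v : A * A * A) : A := snd v.

Definition dot (u v : R3) : R := p1 u * p1 v + p2 u * p2 v + p3 u * p3 v.

Definition cross (u v : R3) : R3 :=
  (p2 u * p3 v - p3 u * p2 v,
   p3 u * p1 v - p1 u * p3 v,
   p1 u * p2 v - p2 u * p1 v).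

(** The complex bilinear (not Hermitian) extension of [dot]. *)
Definition dotC (u v : C3) : C :=
  (p1 u * p1 v + p2 u * p2 v + p3 u * p3 v)%C.

Definition R3toC3 (v : R3) : C3 := (RtoC (p1 v), RtoC (p2 v), RtoC (p3 v)).

(** Orthogonal projection onto the line spanned by [w] (for [w <> 0]). *)
Definition proj (w v : R3) : R3 := scal (dot v w / dot w w) w.

(** Maps are total on R x R; only their germs at points of the disk matter. *)
Definition in_disk (x y : R) : Prop := x ^ 2 + y ^ 2 < 1.

Definition dx (f : R -> R -> R) (x y : R) : R := Derive (fun t => f t y) x.
Definition dy (f : R -> R -> R) (x y : R) : R := Derive (fun t => f x t) y.

Definition map3 {A B : Type} (D : (R -> R -> A) -> R -> R -> B)
    (F : R -> R -> A * A * A) (x y : R) : B * B * B :=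
  (D (fun s t => p1 (F s t)) x y,
   D (fun s t => p2 (F s t)) x y,
   D (fun s t => p3 (F s t)) x y).

Definition Dx (F : R -> R -> R3) : R -> R -> R3 := map3 dx F.
Definition Dy (F : R -> R -> R3) : R -> R -> R3 := map3 dy F.

Definition dxC (f : R -> R -> C) (x y : R) : C :=
  (dx (fun s t => Re (f s t)) x y, dx (fun s t => Im (f s t)) x y).
Definition dyC (f : R -> R -> C) (x y : R) : C :=
  (dy (fun s t => Re (f s t)) x y, dy (fun s t => Im (f s t)) x y).

Definition dz (f : R -> R -> C) (x y : R) : C :=
  (/ 2 * (dxC f x y - Ci * dyC f x y))%C.
Definition dzbar (f : R -> R -> C) (x y : R) : C :=
  (/ 2 * (dxC f x y + Ci * dyC f x y))%C.

Definition Dz (F : R -> R -> C3) : R -> R -> C3 := map3 dz F.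
Definition Dzbar (F : R -> R -> C3) : R -> R -> C3 := map3 dzbar F.

(** A pair holds one component for each partial derivative. *)
Definition grad (F : R -> R -> R3) (x y : R) : R3 * R3 :=
  (Dx F x y, Dy F x y).
Definition gradperp (F : R -> R -> R3) (x y : R) : R3 * R3 :=
  (opp (Dy F x y), Dx F x y).

Definition on_pair {A B : Type} (f : A -> B) (p : A * A) : B * B :=
  (f (fst p), f (snd p)).

Section Immersion.

Variable Phi : R -> R -> R3.

(** All iterated partial derivatives exist and are jointly continuous. *)
Definition smooth : Prop :=
  forall x y, in_disk x y -> forall n,
    ex_diff_n (fun s t => p1 (Phi s t)) n x y /\
    ex_diff_n (fun s t => p2 (Phi s t)) n x y /\
    ex_diff_n (fun s t => p3 (Phi s t)) n x y.

Definition immersive : Prop :=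
  forall x y, in_disk x y -> forall a b : R,
    plus (scal a (Dx Phi x y)) (scal b (Dy Phi x y)) = zero ->
    a = 0 /\ b = 0.

Definition conformal : Prop :=
  forall x y, in_disk x y ->
    dot (Dx Phi x y) (Dx Phi x y) = dot (Dy Phi x y) (Dy Phi x y) /\
    dot (Dx Phi x y) (Dy Phi x y) = 0.

(** [e2l] is e^{2 lambda}. *)
Definition e2l (x y : R) : R := dot (Dx Phi x y) (Dx Phi x y).

Definition normal (x y : R) : R3 :=
  scal (/ e2l x y) (cross (Dx Phi x y) (Dy Phi x y)).

Definition PhiC (x y : R) : C3 := R3toC3 (Phi x y).

(** The pairing <Phi_{z zbar}, n> is real, since Phi_{z zbar} is a quarter of
    the Laplacian of Phi; [Re] only retypes it. *)
Definition meanH (x y : R) : R :=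
  Re (2 * / RtoC (e2l x y) *
      dotC (Dzbar (Dz PhiC) x y) (R3toC3 (normal x y)))%C.

Definition vecH (x y : R) : R3 := scal (meanH x y) (normal x y).

Definition Omega (x y : R) : C :=
  (2 * dotC (Dz (Dz PhiC) x y) (R3toC3 (normal x y)))%C.

Definition willmore : Prop :=
  forall x y, in_disk x y ->
    (dzbar (dz (fun s t => RtoC (meanH s t))) x y
     + RtoC (Cmod (Omega x y) ^ 2 * / e2l x y / 2 * meanH x y) = 0)%C.

(** Entries of the matrix e^{-2 lambda} <Hess Phi, n>. *)
Definition sff_eps (x y : R) : R :=
  / e2l x y * dot (Dx (Dx Phi) x y) (normal x y).
Definition sff_phi (x y : R) : R :=
  / e2l x y * dot (Dy (Dx Phi) x y) (normal x y).
Definition sff_gam (x y : R) : R :=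
  / e2l x y * dot (Dy (Dy Phi) x y) (normal x y).

Definition Aring_grad (x y : R) : R3 * R3 :=
  let h := (sff_eps x y - sff_gam x y) / 2 in
  (plus (scal h (Dx Phi x y)) (scal (sff_phi x y) (Dy Phi x y)),
   minus (scal (sff_phi x y) (Dx Phi x y)) (scal h (Dy Phi x y))).

Definition Vtra (x y : R) : R3 * R3 :=
  plus (minus (grad vecH x y)
              (scal 3 (on_pair (proj (normal x y)) (grad vecH x y))))
       (on_pair (fun v => cross v (vecH x y)) (gradperp normal x y)).

Definition Vdil (x y : R) : R * R :=
  on_pair (fun v => dot v (Phi x y)) (Vtra x y).

Definition Vrot (x y : R) : R3 * R3 :=
  plus (on_pair (cross (Phi x y)) (Vtra x y))
       (scal (2 * meanH x y) (gradperp Phi x y)).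

Definition Vinv (x y : R) : R3 * R3 :=
  plus (minus (scal (dot (Phi x y) (Phi x y)) (Vtra x y))
              (scal 2 (on_pair (fun c => scal c (Phi x y)) (Vdil x y))))
       (scal 4 (on_pair (fun v => cross (Phi x y) (cross (normal x y) v))
                        (Aring_grad x y))).

Definition Vrot_tilde (x y : R) : R3 * R3 :=
  plus (Vrot x y) (scal 2 (gradperp normal x y)).

End Immersion.

(** Inversion at the origin; its value at the origin is irrelevant. *)
Definition inversion0 (v : R3) : R3 := scal (/ dot v v) v.

(* Main.v *)
(** For a conformal immersion [F] with unit normal [n], Weingarten's equations
    turn the flux into [Vtra F = -2 (n grad H + H A)], where [A] is
    [Aring_grad F].  Let [R] be the reflection in the plane orthogonal to [F]
    and put [c = <n, F>].  The differential of the inversion is [R / |F|^2], so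
    the inverted surface has normal [- R n], mean curvature
    [- (|F|^2 H + 2 c)] and, for [A], the field [- R A]; substituting gives
    [Vinv F].  The laws of [Vdil] and [Vrot_tilde] follow by vector algebra, and
    that of [Vinv] because the inversion is an involution. *)

From Stdlib Require Import Reals Lra FunctionalExtensionality.
From Coquelicot Require Import Coquelicot.
(* Imported last, since [Reals] has another [Dx]. *)
Require Import Defs.

Open Scope R_scope.

(** The conserved quantities nest derivatives up to order three, so the laws of the normal and of
    the mean curvature must hold around the point and not only at it; and the law of [Vinv] needs
    that of [Vtra] for the inverted map itself. Proving [smooth] for the inverted map would mean
    differentiating a quotient to every order. Instead, [regular] describes a class of maps on a
    region that is stable under the inversion: two orders of derivatives of the map and one of its
    mean curvature. That last derivative is of third order in the map, but for the inverted map it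
    is read off from the law of the mean curvature, differentiated once along a coordinate line. *)

(** * Vector algebra in coordinates *)

Lemma R3_eq (u v : R3) : p1 u = p1 v -> p2 u = p2 v -> p3 u = p3 v -> u = v.
Proof.
  destruct u as [[u1 u2] u3], v as [[v1 v2] v3]; cbn.
  now intros -> -> ->.
Qed.

Lemma p_plus (u v : R3) :
  p1 (plus u v) = p1 u + p1 v /\ p2 (plus u v) = p2 u + p2 v /\
  p3 (plus u v) = p3 u + p3 v.
Proof. repeat split. Qed.

Lemma p_minus (u v : R3) :
  p1 (minus u v) = p1 u - p1 v /\ p2 (minus u v) = p2 u - p2 v /\
  p3 (minus u v) = p3 u - p3 v.
Proof. repeat split. Qed.

Lemma p_opp (u : R3) :
  p1 (opp u) = - p1 u /\ p2 (opp u) = - p2 u /\ p3 (opp u) = - p3 u.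
Proof. repeat split. Qed.

Lemma p_scal (c : R) (u : R3) :
  p1 (scal c u) = c * p1 u /\ p2 (scal c u) = c * p2 u /\
  p3 (scal c u) = c * p3 u.
Proof. repeat split. Qed.

Lemma p_cross (u v : R3) :
  p1 (cross u v) = p2 u * p3 v - p3 u * p2 v /\
  p2 (cross u v) = p3 u * p1 v - p1 u * p3 v /\
  p3 (cross u v) = p1 u * p2 v - p2 u * p1 v.
Proof. repeat split. Qed.

(** The operations are rewritten rather than reduced, so that the coordinates of each vector stay
    atoms. [dot] is unfolded in the hypotheses too, so that they still match the side conditions
    left by [field]. *)
Ltac coords :=
  unfold dot in *;
  repeat first
    [ rewrite (proj1 (p_plus _ _)) | rewrite (proj1 (proj2 (p_plus _ _)))
    | rewrite (proj2 (proj2 (p_plus _ _)))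
    | rewrite (proj1 (p_minus _ _)) | rewrite (proj1 (proj2 (p_minus _ _)))
    | rewrite (proj2 (proj2 (p_minus _ _)))
    | rewrite (proj1 (p_opp _)) | rewrite (proj1 (proj2 (p_opp _)))
    | rewrite (proj2 (proj2 (p_opp _)))
    | rewrite (proj1 (p_scal _ _)) | rewrite (proj1 (proj2 (p_scal _ _)))
    | rewrite (proj2 (proj2 (p_scal _ _)))
    | rewrite (proj1 (p_cross _ _)) | rewrite (proj1 (proj2 (p_cross _ _)))
    | rewrite (proj2 (proj2 (p_cross _ _))) ].

Ltac vec tac := apply R3_eq; coords; tac.

Lemma dot_comm (u v : R3) : dot u v = dot v u.
Proof. coords; ring. Qed.

Lemma dot_plus_l (u v w : R3) : dot (plus u v) w = dot u w + dot v w.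
Proof. coords; ring. Qed.

Lemma dot_minus_l (u v w : R3) : dot (minus u v) w = dot u w - dot v w.
Proof. coords; ring. Qed.

Lemma dot_scal_l (c : R) (u w : R3) : dot (scal c u) w = c * dot u w.
Proof. coords; ring. Qed.

Lemma dot_opp_l (u w : R3) : dot (opp u) w = - dot u w.
Proof. coords; ring. Qed.

Lemma dot_scal_r (c : R) (u w : R3) : dot w (scal c u) = c * dot w u.
Proof. coords; ring. Qed.

Lemma dot_cross_l (u v : R3) : dot (cross u v) u = 0.
Proof. coords; ring. Qed.

Lemma dot_cross_r (u v : R3) : dot (cross u v) v = 0.
Proof. coords; ring. Qed.

(** Lagrange's identity; it gives the unit normal its length. *)
Lemma dot_cross_cross (u v : R3) :
  dot (cross u v) (cross u v) = dot u u * dot v v - dot u v ^ 2.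
Proof. coords; ring. Qed.

Lemma dot_self_pos (v : R3) : v <> zero -> 0 < dot v v.
Proof.
  intros Hv; unfold dot.
  destruct (Req_dec (p1 v) 0) as [H1|H1]; [|nra].
  destruct (Req_dec (p2 v) 0) as [H2|H2]; [|nra].
  destruct (Req_dec (p3 v) 0) as [H3|H3]; [|nra].
  destruct Hv; now apply R3_eq.
Qed.

Lemma dot_self_nonneg (v : R3) : 0 <= dot v v.
Proof. unfold dot; nra. Qed.

(** * Oriented conformal frames *)

(** In a conformal frame [cross a b] has length [dot a a]. At [Dx F x y] and [Dy F x y] this is
    convertible with [normal F x y], on which later [change] steps rely. *)
Definition unit_normal (a b : R3) : R3 := scal (/ dot a a) (cross a b).

Definition conformal_frame (a b : R3) : Prop :=
  dot a a = dot b b /\ dot a b = 0 /\ 0 < dot a a.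

Section Frame.

Variables a b : R3.
Hypothesis Hab : conformal_frame a b.

Let n := unit_normal a b.

Lemma dot_normal_l : dot n a = 0.
Proof. unfold n, unit_normal; rewrite dot_scal_l, dot_cross_l; ring. Qed.

Lemma dot_normal_r : dot n b = 0.
Proof. unfold n, unit_normal; rewrite dot_scal_l, dot_cross_r; ring. Qed.

Lemma dot_normal_normal : dot n n = 1.
Proof.
  destruct Hab as (H1 & H2 & H3).
  unfold n, unit_normal.
  rewrite dot_scal_l, dot_scal_r, dot_cross_cross, H2, <- H1.
  field; lra.
Qed.

(** The triple product a x (a x b) = <a, b> a - <a, a> b, divided by <a, a>. *)
Lemma cross_l_normal : cross a n = opp b.
Proof.
  destruct Hab as (H1 & H2 & H3); unfold n, unit_normal.
  transitivity (minus (scal (dot a b / dot a a) a) b).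
  - vec ltac:(field; unfold dot in H3; lra).
  - rewrite H2; vec ltac:(unfold Rdiv; ring).
Qed.

Lemma cross_r_normal : cross b n = a.
Proof.
  destruct Hab as (H1 & H2 & H3); unfold n, unit_normal.
  transitivity (minus (scal (dot b b / dot a a) a) (scal (dot a b / dot a a) b)).
  - vec ltac:(field; unfold dot in H3; lra).
  - rewrite H2, <- H1; unfold Rdiv; rewrite Rinv_r by lra; vec ltac:(ring).
Qed.

Lemma frame_decomposition (v : R3) :
  v = plus (scal (dot v n) n)
        (scal (/ dot a a) (plus (scal (dot v a) a) (scal (dot v b) b))).
Proof.
  destruct Hab as (H1 & H2 & H3).
  set (E := dot a a) in *.
  (* Cramer's rule in the basis a, b, a x b: multiplied by the Gram determinant <a, a><b, b> - <a,
     b>^2, the decomposition is a polynomial identity for arbitrary a and b. Orthogonality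
     simplifies it afterwards. *)
  assert (G : scal (E * E) v =
    plus (scal (dot v (cross a b)) (cross a b))
      (plus (scal (dot b b * dot v a - dot a b * dot v b) a)
            (scal (E * dot v b - dot a b * dot v a) b))).
  { transitivity (scal (dot a a * dot b b - dot a b ^ 2) v).
    - rewrite H2, <- H1; f_equal; unfold E; ring.
    - unfold E; vec ltac:(ring). }
  rewrite H2, <- H1 in G.
  transitivity (scal (/ (E * E)) (scal (E * E) v)).
  - vec ltac:(field; lra).
  - rewrite G; unfold n, unit_normal; rewrite dot_scal_r; fold E.
    generalize (dot v (cross a b)) (dot v a) (dot v b) (cross a b).
    intros; vec ltac:(field; lra).
Qed.

End Frame.

(** * Curves in R^3 *)

Definition is_derive3 (f : R -> R3) (t : R) (v : R3) : Prop :=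
  is_derive (fun s => p1 (f s)) t (p1 v) /\
  is_derive (fun s => p2 (f s)) t (p2 v) /\
  is_derive (fun s => p3 (f s)) t (p3 v).

Lemma is_derive3_ext_loc (f g : R -> R3) (t : R) (v : R3) :
  locally t (fun s => f s = g s) -> is_derive3 f t v -> is_derive3 g t v.
Proof.
  intros H (H1 & H2 & H3); split; [|split];
    (eapply is_derive_ext_loc; [|eassumption]);
    (eapply filter_imp; [|exact H]); cbv beta; now intros s ->.
Qed.

Lemma is_derive_eq (f : R -> R) (t d d' : R) :
  is_derive f t d -> d = d' -> is_derive f t d'.
Proof. now intros H <-. Qed.

(** This rule and the next ones are restated with the operations of R, so that goals match them
    syntactically. *)
Lemma is_derive_Rplus (f g : R -> R) (t a b : R) :
  is_derive f t a -> is_derive g t b -> is_derive (fun s => f s + g s) t (a + b).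
Proof. exact (is_derive_plus (V := R_NormedModule) f g t a b). Qed.

Lemma is_derive_Rminus (f g : R -> R) (t a b : R) :
  is_derive f t a -> is_derive g t b -> is_derive (fun s => f s - g s) t (a - b).
Proof. exact (is_derive_minus (V := R_NormedModule) f g t a b). Qed.

Lemma is_derive_Ropp (f : R -> R) (t a : R) :
  is_derive f t a -> is_derive (fun s => - f s) t (- a).
Proof. exact (is_derive_opp (V := R_NormedModule) f t a). Qed.

Lemma is_derive_Rmult (f g : R -> R) (t a b : R) :
  is_derive f t a -> is_derive g t b ->
  is_derive (fun s => f s * g s) t (a * g t + f t * b).
Proof. intros Hf Hg; exact (is_derive_mult f g t a b Hf Hg Rmult_comm). Qed.

Ltac derive_poly_step :=
  lazymatch goal with
  | |- is_derive (fun s => @?f s + @?g s) _ _ => apply (is_derive_Rplus f g)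
  | |- is_derive (fun s => @?f s - @?g s) _ _ => apply (is_derive_Rminus f g)
  | |- is_derive (fun s => @?f s * @?g s) _ _ => apply (is_derive_Rmult f g)
  | H : is_derive ?f ?t _ |- is_derive ?f ?t _ => exact H
  end.

Ltac derive_poly := eapply is_derive_eq; [repeat derive_poly_step|].

Lemma is_derive_dot (f g : R -> R3) (t : R) (u v : R3) :
  is_derive3 f t u -> is_derive3 g t v ->
  is_derive (fun s => dot (f s) (g s)) t (dot u (g t) + dot (f t) v).
Proof.
  intros (H1 & H2 & H3) (H4 & H5 & H6); unfold dot.
  derive_poly; cbv beta; ring.
Qed.

Lemma is_derive3_cross (f g : R -> R3) (t : R) (u v : R3) :
  is_derive3 f t u -> is_derive3 g t v ->
  is_derive3 (fun s => cross (f s) (g s)) t (plus (cross u (g t)) (cross (f t) v)).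
Proof.
  intros (H1 & H2 & H3) (H4 & H5 & H6); split; [|split]; coords;
    [ change (is_derive (fun s => p2 (f s) * p3 (g s) - p3 (f s) * p2 (g s)) t
        (p2 u * p3 (g t) - p3 u * p2 (g t) + (p2 (f t) * p3 v - p3 (f t) * p2 v)))
    | change (is_derive (fun s => p3 (f s) * p1 (g s) - p1 (f s) * p3 (g s)) t
        (p3 u * p1 (g t) - p1 u * p3 (g t) + (p3 (f t) * p1 v - p1 (f t) * p3 v)))
    | change (is_derive (fun s => p1 (f s) * p2 (g s) - p2 (f s) * p1 (g s)) t
        (p1 u * p2 (g t) - p2 u * p1 (g t) + (p1 (f t) * p2 v - p2 (f t) * p1 v))) ];
    derive_poly; cbv beta; ring.
Qed.

Lemma is_derive3_scal (c : R -> R) (f : R -> R3) (t c' : R) (v : R3) :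
  is_derive c t c' -> is_derive3 f t v ->
  is_derive3 (fun s => scal (c s) (f s)) t (plus (scal c' (f t)) (scal (c t) v)).
Proof.
  intros Hc (H1 & H2 & H3); split; [|split]; coords;
    apply is_derive_Rmult; assumption.
Qed.

Lemma is_derive3_minus (f g : R -> R3) (t : R) (u v : R3) :
  is_derive3 f t u -> is_derive3 g t v ->
  is_derive3 (fun s => minus (f s) (g s)) t (minus u v).
Proof.
  intros (H1 & H2 & H3) (H4 & H5 & H6); split; [|split]; coords;
    apply is_derive_Rminus; assumption.
Qed.

Lemma is_derive3_eq (f : R -> R3) (t : R) (v v' : R3) :
  is_derive3 f t v -> v = v' -> is_derive3 f t v'.
Proof. now intros H <-. Qed.

Lemma is_derive_unique_loc (f g : R -> R) (t a b : R) :
  locally t (fun s => f s = g s) -> is_derive f t a -> is_derive g t b -> a = b.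
Proof.
  intros H Hf Hg.
  rewrite <- (is_derive_unique _ _ _ Hg).
  symmetry; apply is_derive_unique.
  now apply (is_derive_ext_loc f).
Qed.

(** Serves to show that the normal is differentiable; the useful form of its derivative comes from
    [weingarten]. *)
Lemma is_derive3_unit_normal (a b : R -> R3) (t : R) (a' b' : R3) :
  is_derive3 a t a' -> is_derive3 b t b' -> dot (a t) (a t) <> 0 ->
  is_derive3 (fun s => unit_normal (a s) (b s)) t
    (plus (scal (- (2 * dot (a t) a') / dot (a t) (a t) ^ 2) (cross (a t) (b t)))
          (scal (/ dot (a t) (a t)) (plus (cross a' (b t)) (cross (a t) b')))).
Proof.
  intros Ha Hb Hn; unfold unit_normal.
  apply (is_derive3_scal (fun s => / dot (a s) (a s)) (fun s => cross (a s) (b s)));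
    [|exact (is_derive3_cross _ _ _ _ _ Ha Hb)].
  eapply is_derive_eq;
    [exact (is_derive_inv _ _ _ (is_derive_dot _ _ _ _ _ Ha Ha) Hn)|].
  cbv beta; rewrite (dot_comm a'); unfold Rdiv; f_equal; ring.
Qed.

(* Weingarten's equation: [n'] has no normal part since [|n| = 1], and its
   tangential part comes from differentiating [<n, a> = <n, b> = 0]. *)
Lemma weingarten (a b : R -> R3) (t : R) (a' b' : R3) :
  is_derive3 a t a' -> is_derive3 b t b' ->
  locally t (fun s => conformal_frame (a s) (b s)) ->
  let n := unit_normal (a t) (b t) in
  is_derive3 (fun s => unit_normal (a s) (b s)) t
    (opp (scal (/ dot (a t) (a t))
       (plus (scal (dot a' n) (a t)) (scal (dot b' n) (b t))))).
Proof.
  intros Ha Hb Hloc n.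
  assert (Ht := locally_singleton _ _ Hloc); cbv beta in Ht.
  assert (Hn0 : dot (a t) (a t) <> 0) by (destruct Ht as (_ & _ & ?); lra).
  assert (Hn := is_derive3_unit_normal a b t a' b' Ha Hb Hn0).
  revert Hn; generalize
    (plus (scal (- (2 * dot (a t) a') / dot (a t) (a t) ^ 2) (cross (a t) (b t)))
          (scal (/ dot (a t) (a t)) (plus (cross a' (b t)) (cross (a t) b')))).
  intros n' Hn.
  eapply is_derive3_eq; [exact Hn|].
  assert (H0 : 2 * dot n' n = 0).
  { apply (is_derive_unique_loc (fun s => dot (unit_normal (a s) (b s))
      (unit_normal (a s) (b s))) (fun _ => 1) t).
    - eapply filter_imp; [|exact Hloc]; intros s Hs; now apply dot_normal_normal.
    - eapply is_derive_eq; [exact (is_derive_dot _ _ _ _ _ Hn Hn)|].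
      cbv beta; fold n; rewrite (dot_comm n n'); ring.
    - exact (is_derive_const (V := R_NormedModule) 1 t). }
  assert (H1 : dot n' (a t) + dot n a' = 0).
  { apply (is_derive_unique_loc (fun s => dot (unit_normal (a s) (b s)) (a s))
      (fun _ => 0) t).
    - apply filter_forall; intros s; apply dot_normal_l.
    - exact (is_derive_dot _ _ _ _ _ Hn Ha).
    - exact (is_derive_const (V := R_NormedModule) 0 t). }
  assert (H2 : dot n' (b t) + dot n b' = 0).
  { apply (is_derive_unique_loc (fun s => dot (unit_normal (a s) (b s)) (b s))
      (fun _ => 0) t).
    - apply filter_forall; intros s; apply dot_normal_r.
    - exact (is_derive_dot _ _ _ _ _ Hn Hb).
    - exact (is_derive_const (V := R_NormedModule) 0 t). }
  rewrite (frame_decomposition (a t) (b t) Ht n'); fold n.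
  rewrite (dot_comm n) in H1, H2.
  replace (dot n' n) with 0 by lra.
  replace (dot n' (a t)) with (- dot a' n) by lra.
  replace (dot n' (b t)) with (- dot b' n) by lra.
  vec ltac:(ring).
Qed.

(** * The inversion along curves *)

Definition dinv (p v : R3) : R3 :=
  scal (/ dot p p) (minus v (scal (2 * dot v p / dot p p) p)).

(** The second differential of the inversion at p: the derivative of [dinv p v] as p moves in the
    direction w. *)
Definition d2inv (p v w : R3) : R3 :=
  minus (scal (8 * dot v p * dot w p / dot p p ^ 3 - 2 * dot v w / dot p p ^ 2) p)
    (plus (scal (2 * dot w p / dot p p ^ 2) v) (scal (2 * dot v p / dot p p ^ 2) w)).

Lemma is_derive3_inversion (f : R -> R3) (t : R) (v : R3) :
  is_derive3 f t v -> dot (f t) (f t) <> 0 ->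
  is_derive3 (fun s => inversion0 (f s)) t (dinv (f t) v).
Proof.
  intros Hf Hn; unfold inversion0.
  eapply is_derive3_eq.
  { exact (is_derive3_scal _ _ _ _ _
      (is_derive_inv _ _ _ (is_derive_dot _ _ _ _ _ Hf Hf) Hn) Hf). }
  cbv beta.
  unfold dinv; rewrite (dot_comm (f t) v).
  (* Scalar products become atoms before coordinates appear, so that [field] meets few variables;
     [generalize dependent] carries the nonvanishing hypothesis along. *)
  generalize dependent (dot (f t) (f t)); generalize (dot v (f t)).
  intros; vec ltac:(field; assumption).
Qed.

Lemma is_derive3_dinv (f g : R -> R3) (t : R) (w v' : R3) :
  is_derive3 f t w -> is_derive3 g t v' -> dot (f t) (f t) <> 0 ->
  is_derive3 (fun s => dinv (f s) (g s)) t
    (plus (d2inv (f t) (g t) w) (dinv (f t) v')).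
Proof.
  intros Hf Hg Hn; unfold dinv.
  assert (Hff := is_derive_dot _ _ _ _ _ Hf Hf).
  assert (Hgf := is_derive_dot _ _ _ _ _ Hg Hf).
  eapply is_derive3_eq.
  { exact (is_derive3_scal _ _ _ _ _ (is_derive_inv _ _ _ Hff Hn)
      (is_derive3_minus _ _ _ _ _ Hg
        (is_derive3_scal _ _ _ _ _
          (is_derive_div _ _ _ _ _ (is_derive_scal _ _ 2 _ Hgf) Hff Hn) Hf))). }
  cbv beta.
  unfold d2inv; rewrite (dot_comm (f t) w).
  generalize dependent (dot (f t) (f t)).
  generalize (dot (g t) (f t)) (dot w (f t)) (dot v' (f t)) (dot (g t) w).
  intros; vec ltac:(field; assumption).
Qed.

(** This gives the inverted map the symmetric mixed derivatives that [reg_yx] demands. *)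
Lemma d2inv_comm (p v w : R3) : d2inv p v w = d2inv p w v.
Proof. unfold d2inv; rewrite (dot_comm v w); vec ltac:(unfold Rdiv; ring). Qed.

Definition reflection (p v : R3) : R3 := minus v (scal (2 * dot v p / dot p p) p).

Lemma dot_reflection_reflectionection (p u v : R3) :
  dot p p <> 0 -> dot (reflection p u) (reflection p v) = dot u v.
Proof. intros Hp; unfold reflection; coords; field; assumption. Qed.

Lemma dot_dinv_dinv (p u v : R3) :
  dot p p <> 0 -> dot (dinv p u) (dinv p v) = / dot p p ^ 2 * dot u v.
Proof.
  intros Hp; unfold dinv; fold (reflection p u); fold (reflection p v).
  rewrite dot_scal_l, dot_scal_r, dot_reflection_reflectionection by assumption.
  field; assumption.
Qed.

Lemma conformal_frame_dinv (p a b : R3) :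
  dot p p <> 0 -> conformal_frame a b -> conformal_frame (dinv p a) (dinv p b).
Proof.
  intros Hp (H1 & H2 & H3); unfold conformal_frame.
  rewrite !dot_dinv_dinv by assumption.
  rewrite <- H1, H2; repeat split; try ring.
  apply Rmult_lt_0_compat; [|assumption].
  apply Rinv_0_lt_compat; apply pow_lt.
  assert (H := dot_self_nonneg p); lra.
Qed.

(* The inversion reverses orientation, hence the sign. *)
Lemma unit_normal_dinv (p a b : R3) :
  dot p p <> 0 -> dot a a <> 0 ->
  unit_normal (dinv p a) (dinv p b) = opp (reflection p (unit_normal a b)).
Proof.
  intros Hp Ha; unfold unit_normal at 1.
  rewrite dot_dinv_dinv by assumption.
  replace (cross (dinv p a) (dinv p b))
    with (scal (- / dot p p ^ 2) (reflection p (cross a b))).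
  - unfold unit_normal, reflection; rewrite dot_scal_l.
    generalize dependent (dot p p); generalize dependent (dot a a).
    intros; vec ltac:(field; split; assumption).
  - unfold dinv, reflection; vec ltac:(field; assumption).
Qed.

(** The source of the law of the second fundamental form. The reflection R is an isometry, so the
    [dinv] part yields <a, m>. In [d2inv] paired with R m, the terms containing <v, p><w, p> cancel
    and a multiple of the metric <v, w> survives. The intermediate identity keeps <m, v> and <m, w>,
    so that [field] proves it for every m. *)
Lemma dot_second_derivative_inversion (p v w a m : R3) :
  dot p p <> 0 -> dot m v = 0 -> dot m w = 0 ->
  dot (plus (d2inv p v w) (dinv p a)) (opp (reflection p m)) =
  - (/ dot p p * dot a m + 2 * dot v w * dot m p / dot p p ^ 2).
Proof.
  intros Hp Hv Hw.
  transitivity (- (/ dot p p * dot a m + 2 * dot v w * dot m p / dot p p ^ 2)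
    + 2 * dot w p / dot p p ^ 2 * dot m v + 2 * dot v p / dot p p ^ 2 * dot m w).
  - unfold d2inv, dinv, reflection; coords; field; assumption.
  - rewrite Hv, Hw; ring.
Qed.

(** * Conformal maps on a region *)

(** Partial derivatives see a region only along the two coordinate lines, so openness is asked
    there. *)
Definition line_open (U : R -> R -> Prop) : Prop :=
  forall s t, U s t ->
    locally s (fun s' => U s' t) /\ locally t (fun t' => U s t').

(* The field [reg_yx] contains the symmetry of the mixed second derivatives. *)
Record regular (U : R -> R -> Prop) (F : R -> R -> R3) : Prop := {
  reg_x : forall s t, U s t -> is_derive3 (fun s' => F s' t) s (Dx F s t);
  reg_y : forall s t, U s t -> is_derive3 (fun t' => F s t') t (Dy F s t);
  reg_xx : forall s t, U s t ->
    is_derive3 (fun s' => Dx F s' t) s (Dx (Dx F) s t);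
  reg_xy : forall s t, U s t ->
    is_derive3 (fun t' => Dx F s t') t (Dy (Dx F) s t);
  reg_yx : forall s t, U s t ->
    is_derive3 (fun s' => Dy F s' t) s (Dy (Dx F) s t);
  reg_yy : forall s t, U s t ->
    is_derive3 (fun t' => Dy F s t') t (Dy (Dy F) s t);
  reg_frame : forall s t, U s t -> conformal_frame (Dx F s t) (Dy F s t);
  reg_Hx : forall s t, U s t -> ex_derive (fun s' => meanH F s' t) s;
  reg_Hy : forall s t, U s t -> ex_derive (fun t' => meanH F s t') t
}.

Lemma Dx_unique (F : R -> R -> R3) (s t : R) (v : R3) :
  is_derive3 (fun s' => F s' t) s v -> Dx F s t = v.
Proof. intros (H1 & H2 & H3); apply R3_eq; apply is_derive_unique; assumption. Qed.

Lemma Dy_unique (F : R -> R -> R3) (s t : R) (v : R3) :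
  is_derive3 (fun t' => F s t') t v -> Dy F s t = v.
Proof. intros (H1 & H2 & H3); apply R3_eq; apply is_derive_unique; assumption. Qed.

(** Holds for every f: the mixed derivatives fall into the imaginary part, and the real part only
    needs constant factors pulled out of [Derive], which is unconditional. *)
Lemma Re_dzbar_dz (f : R -> R -> R) (x y : R) :
  Re (dzbar (dz (fun s t => RtoC (f s t))) x y) =
  / 4 * (dx (dx f) x y + dy (dy f) x y).
Proof.
  replace (dz (fun s t => RtoC (f s t)))
    with (fun s t => (/ 2 * dx f s t, - / 2 * dy f s t) : C).
  - transitivity (/ 2 * (dx (fun s t => / 2 * dx f s t) x y
                         - dy (fun s t => - / 2 * dy f s t) x y)).
    + unfold dzbar, dxC, dyC, dx, dy; cbn; field.
    + unfold dx at 1, dy at 1; rewrite !Derive_scal.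
      unfold dx, dy; field.
  - apply functional_extensionality; intros s.
    apply functional_extensionality; intros t.
    unfold dz, dxC, dyC, dx, dy; cbn; rewrite !Derive_const.
    apply injective_projections; cbn; field.
Qed.

(** Half the trace of the second fundamental form: the form in which later arguments use the mean
    curvature. *)
Lemma meanH_eq (F : R -> R -> R3) (x y : R) :
  e2l F x y <> 0 -> meanH F x y = (sff_eps F x y + sff_gam F x y) / 2.
Proof.
  intros He; unfold meanH.
  transitivity (2 * / e2l F x y *
    Re (dotC (Dzbar (Dz (PhiC F)) x y) (R3toC3 (normal F x y)))).
  { rewrite <- RtoC_inv by assumption.
    rewrite <- RtoC_mult; cbn; ring. }
  unfold sff_eps, sff_gam.
  generalize (normal F x y); intros n.
  transitivity (2 * / e2l F x y *
    (Re (p1 (Dzbar (Dz (PhiC F)) x y)) * p1 n +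
     Re (p2 (Dzbar (Dz (PhiC F)) x y)) * p2 n +
     Re (p3 (Dzbar (Dz (PhiC F)) x y)) * p3 n)).
  { f_equal; unfold dotC, R3toC3; cbn; ring. }
  change (2 * / e2l F x y *
    (Re (dzbar (dz (fun s t => RtoC (p1 (F s t)))) x y) * p1 n +
     Re (dzbar (dz (fun s t => RtoC (p2 (F s t)))) x y) * p2 n +
     Re (dzbar (dz (fun s t => RtoC (p3 (F s t)))) x y) * p3 n) =
    (/ e2l F x y *
       (dx (dx (fun s t => p1 (F s t))) x y * p1 n +
        dx (dx (fun s t => p2 (F s t))) x y * p2 n +
        dx (dx (fun s t => p3 (F s t))) x y * p3 n) +
     / e2l F x y *
       (dy (dy (fun s t => p1 (F s t))) x y * p1 n +
        dy (dy (fun s t => p2 (F s t))) x y * p2 n +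
        dy (dy (fun s t => p3 (F s t))) x y * p3 n)) / 2).
  rewrite !Re_dzbar_dz; field; assumption.
Qed.

Section Regular.

Variables (U : R -> R -> Prop) (F : R -> R -> R3).
Hypotheses (U_open : line_open U) (F_regular : regular U F).
Variables x y : R.
Hypothesis Uxy : U x y.

Let X := Dx F x y.
Let Y := Dy F x y.
Let n := normal F x y.
Let h := meanH F x y.
Let Ax := fst (Aring_grad F x y).
Let Ay := snd (Aring_grad F x y).

Lemma regular_frame : conformal_frame X Y.
Proof. exact (reg_frame U F F_regular x y Uxy). Qed.

Lemma regular_e2l : e2l F x y <> 0.
Proof. destruct regular_frame as (_ & _ & H); unfold e2l; fold X; lra. Qed.

Lemma regular_meanH : h = (sff_eps F x y + sff_gam F x y) / 2.
Proof. exact (meanH_eq F x y regular_e2l). Qed.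

Lemma is_derive3_normal_x :
  is_derive3 (fun s => normal F s y) x (opp (plus (scal h X) Ax)).
Proof.
  eapply is_derive3_eq.
  { apply (weingarten (fun s => Dx F s y) (fun s => Dy F s y) x
      (Dx (Dx F) x y) (Dy (Dx F) x y)).
    - exact (reg_xx U F F_regular x y Uxy).
    - exact (reg_yx U F F_regular x y Uxy).
    - eapply filter_imp; [|exact (proj1 (U_open x y Uxy))].
      intros s Hs; exact (reg_frame U F F_regular s y Hs). }
  unfold Ax, Aring_grad; cbn [fst]; rewrite regular_meanH.
  (* The trace is split off by eps = H + (eps - gam) / 2. *)
  transitivity (opp (plus (scal (sff_eps F x y) X) (scal (sff_phi F x y) Y))).
  - unfold sff_eps, sff_phi; fold n.
    change (unit_normal (Dx F x y) (Dy F x y)) with n.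
    fold X Y; change (e2l F x y) with (dot X X).
    generalize (/ dot X X) (dot (Dx (Dx F) x y) n) (dot (Dy (Dx F) x y) n).
    intros; vec ltac:(ring).
  - fold X Y; vec ltac:(field).
Qed.

Lemma is_derive3_normal_y :
  is_derive3 (fun t => normal F x t) y (opp (plus (scal h Y) Ay)).
Proof.
  eapply is_derive3_eq.
  { apply (weingarten (fun t => Dx F x t) (fun t => Dy F x t) y
      (Dy (Dx F) x y) (Dy (Dy F) x y)).
    - exact (reg_xy U F F_regular x y Uxy).
    - exact (reg_yy U F F_regular x y Uxy).
    - eapply filter_imp; [|exact (proj2 (U_open x y Uxy))].
      intros t Ht; exact (reg_frame U F F_regular x t Ht). }
  unfold Ay, Aring_grad; cbn [snd]; rewrite regular_meanH.
  transitivity (opp (plus (scal (sff_phi F x y) X) (scal (sff_gam F x y) Y))).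
  - unfold sff_phi, sff_gam; fold n.
    change (unit_normal (Dx F x y) (Dy F x y)) with n.
    fold X Y; change (e2l F x y) with (dot X X).
    generalize (/ dot X X) (dot (Dy (Dy F) x y) n) (dot (Dy (Dx F) x y) n).
    intros; vec ltac:(ring).
  - fold X Y; vec ltac:(field).
Qed.

(** On the tangent plane [cross n] is the quarter turn taking X to Y, and a symmetric trace-free
    operator anticommutes with it. *)
Lemma cross_normal_Aring : cross n Ax = opp Ay /\ cross n Ay = Ax.
Proof.
  assert (H1 := cross_l_normal X Y regular_frame).
  assert (H2 := cross_r_normal X Y regular_frame).
  change (unit_normal X Y) with n in *.
  unfold Ax, Ay, Aring_grad; cbn [fst snd]; fold X Y.
  generalize (sff_phi F x y) ((sff_eps F x y - sff_gam F x y) / 2).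
  intros f e; split.
  - transitivity (minus (scal (- e) (cross X n)) (scal f (cross Y n))).
    + vec ltac:(ring).
    + rewrite H1, H2; vec ltac:(ring).
  - transitivity (minus (scal e (cross Y n)) (scal f (cross X n))).
    + vec ltac:(ring).
    + rewrite H1, H2; vec ltac:(ring).
Qed.

Let Hx := Derive (fun s => meanH F s y) x.
Let Hy := Derive (fun t => meanH F x t) y.

Lemma Aring_normal : dot Ax n = 0 /\ dot Ay n = 0.
Proof.
  assert (H1 := dot_normal_l X Y); assert (H2 := dot_normal_r X Y).
  change (unit_normal X Y) with n in *; rewrite dot_comm in H1, H2.
  unfold Ax, Ay, Aring_grad; cbn [fst snd]; fold X Y.
  rewrite dot_plus_l, dot_minus_l, !dot_scal_l, H1, H2; split; ring.
Qed.

(** Shared by both components: Z is X or Y, W the derivative of [vecH], and D the matching component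
    of [gradperp] of the normal. The triple projection turns k n into -2 k n; the tangential terms
    h^2 Z of W and of [cross D (scal h n)] cancel, while their terms -h A add up. *)
Lemma Vtra_algebra (k : R) (Z A D : R3) :
  dot Z n = 0 -> dot A n = 0 -> cross D n = minus (scal h Z) A ->
  let W := plus (scal k n) (scal h (opp (plus (scal h Z) A))) in
  plus (minus W (scal 3 (proj n W))) (cross D (scal h n)) =
  scal (-2) (plus (scal k n) (scal h A)).
Proof.
  intros HZ HA HD W.
  assert (Hn : dot n n = 1) by exact (dot_normal_normal X Y regular_frame).
  assert (HW : dot W n = k).
  { unfold W; rewrite dot_plus_l, !dot_scal_l, dot_opp_l, dot_plus_l, dot_scal_l.
    rewrite Hn, HZ, HA; ring. }
  unfold proj; rewrite HW, Hn.
  transitivity (plus (minus W (scal 3 (scal (k / 1) n))) (scal h (cross D n))).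
  - vec ltac:(ring).
  - rewrite HD; unfold W; vec ltac:(field).
Qed.

Lemma Vtra_x : fst (Vtra F x y) = scal (-2) (plus (scal Hx n) (scal h Ax)).
Proof.
  assert (Hn := is_derive3_normal_x).
  assert (HV := is_derive3_scal _ _ _ _ _
    (Derive_correct _ _ (reg_Hx U F F_regular x y Uxy)) Hn).
  cbv beta in HV; fold n h in HV.
  transitivity (plus (minus (Dx (vecH F) x y) (scal 3 (proj n (Dx (vecH F) x y))))
    (cross (opp (Dy (normal F) x y)) (scal h n))); [reflexivity|].
  rewrite (Dx_unique _ _ _ _ HV), (Dy_unique _ _ _ _ is_derive3_normal_y).
  apply Vtra_algebra.
  - rewrite dot_comm; exact (dot_normal_l X Y).
  - apply Aring_normal.
  - transitivity (minus (scal h (cross Y n)) (cross n Ay)); [vec ltac:(ring)|].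
    rewrite (proj2 cross_normal_Aring).
    f_equal; f_equal; exact (cross_r_normal X Y regular_frame).
Qed.

Lemma Vtra_y : snd (Vtra F x y) = scal (-2) (plus (scal Hy n) (scal h Ay)).
Proof.
  assert (Hn := is_derive3_normal_y).
  assert (HV := is_derive3_scal _ _ _ _ _
    (Derive_correct _ _ (reg_Hy U F F_regular x y Uxy)) Hn).
  cbv beta in HV; fold n h in HV.
  transitivity (plus (minus (Dy (vecH F) x y) (scal 3 (proj n (Dy (vecH F) x y))))
    (cross (Dx (normal F) x y) (scal h n))); [reflexivity|].
  rewrite (Dy_unique _ _ _ _ HV), (Dx_unique _ _ _ _ is_derive3_normal_x).
  apply Vtra_algebra.
  - rewrite dot_comm; exact (dot_normal_r X Y).
  - apply Aring_normal.
  - transitivity (plus (scal (- h) (cross X n)) (cross n Ax)); [vec ltac:(ring)|].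
    rewrite (proj1 cross_normal_Aring).
    transitivity (plus (scal (- h) (opp Y)) (opp Ay)); [|vec ltac:(ring)].
    f_equal; f_equal; exact (cross_l_normal X Y regular_frame).
Qed.

End Regular.

(** * The inversion of a conformal map *)

Section Inversion.

Variables (U : R -> R -> Prop) (F : R -> R -> R3).
Hypotheses (U_open : line_open U) (F_regular : regular U F).
Hypothesis F_neq0 : forall s t, U s t -> dot (F s t) (F s t) <> 0.

Let G := fun s t => inversion0 (F s t).

Lemma inversion_is_derive_x (s t : R) : U s t ->
  is_derive3 (fun s' => G s' t) s (dinv (F s t) (Dx F s t)).
Proof.
  intros Hst.
  exact (is_derive3_inversion _ _ _ (reg_x U F F_regular s t Hst) (F_neq0 s t Hst)).
Qed.

Lemma inversion_is_derive_y (s t : R) : U s t ->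
  is_derive3 (fun t' => G s t') t (dinv (F s t) (Dy F s t)).
Proof.
  intros Hst.
  exact (is_derive3_inversion _ _ _ (reg_y U F F_regular s t Hst) (F_neq0 s t Hst)).
Qed.

Lemma inversion_Dx (s t : R) : U s t -> Dx G s t = dinv (F s t) (Dx F s t).
Proof. intros Hst; exact (Dx_unique _ _ _ _ (inversion_is_derive_x s t Hst)). Qed.

Lemma inversion_Dy (s t : R) : U s t -> Dy G s t = dinv (F s t) (Dy F s t).
Proof. intros Hst; exact (Dy_unique _ _ _ _ (inversion_is_derive_y s t Hst)). Qed.

Lemma inversion_is_derive_xx (s t : R) : U s t ->
  is_derive3 (fun s' => Dx G s' t) s
    (plus (d2inv (F s t) (Dx F s t) (Dx F s t)) (dinv (F s t) (Dx (Dx F) s t))).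
Proof.
  intros Hst.
  eapply is_derive3_ext_loc.
  2: exact (is_derive3_dinv _ _ _ _ _ (reg_x U F F_regular s t Hst)
       (reg_xx U F F_regular s t Hst) (F_neq0 s t Hst)).
  eapply filter_imp; [|exact (proj1 (U_open s t Hst))].
  intros s' Hs'; symmetry; exact (inversion_Dx s' t Hs').
Qed.

Lemma inversion_is_derive_xy (s t : R) : U s t ->
  is_derive3 (fun t' => Dx G s t') t
    (plus (d2inv (F s t) (Dx F s t) (Dy F s t)) (dinv (F s t) (Dy (Dx F) s t))).
Proof.
  intros Hst.
  eapply is_derive3_ext_loc.
  2: exact (is_derive3_dinv _ _ _ _ _ (reg_y U F F_regular s t Hst)
       (reg_xy U F F_regular s t Hst) (F_neq0 s t Hst)).
  eapply filter_imp; [|exact (proj2 (U_open s t Hst))].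
  intros t' Ht'; symmetry; exact (inversion_Dx s t' Ht').
Qed.

Lemma inversion_is_derive_yx (s t : R) : U s t ->
  is_derive3 (fun s' => Dy G s' t) s
    (plus (d2inv (F s t) (Dx F s t) (Dy F s t)) (dinv (F s t) (Dy (Dx F) s t))).
Proof.
  intros Hst; rewrite d2inv_comm.
  eapply is_derive3_ext_loc.
  2: exact (is_derive3_dinv _ _ _ _ _ (reg_x U F F_regular s t Hst)
       (reg_yx U F F_regular s t Hst) (F_neq0 s t Hst)).
  eapply filter_imp; [|exact (proj1 (U_open s t Hst))].
  intros s' Hs'; symmetry; exact (inversion_Dy s' t Hs').
Qed.

Lemma inversion_is_derive_yy (s t : R) : U s t ->
  is_derive3 (fun t' => Dy G s t') t
    (plus (d2inv (F s t) (Dy F s t) (Dy F s t)) (dinv (F s t) (Dy (Dy F) s t))).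
Proof.
  intros Hst.
  eapply is_derive3_ext_loc.
  2: exact (is_derive3_dinv _ _ _ _ _ (reg_y U F F_regular s t Hst)
       (reg_yy U F F_regular s t Hst) (F_neq0 s t Hst)).
  eapply filter_imp; [|exact (proj2 (U_open s t Hst))].
  intros t' Ht'; symmetry; exact (inversion_Dy s t' Ht').
Qed.

Lemma inversion_frame (s t : R) : U s t -> conformal_frame (Dx G s t) (Dy G s t).
Proof.
  intros Hst; rewrite inversion_Dx, inversion_Dy by assumption.
  apply conformal_frame_dinv; [now apply F_neq0|].
  exact (reg_frame U F F_regular s t Hst).
Qed.

Lemma inversion_normal (s t : R) : U s t ->
  normal G s t = opp (reflection (F s t) (normal F s t)).
Proof.
  intros Hst.
  change (unit_normal (Dx G s t) (Dy G s t) =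
    opp (reflection (F s t) (unit_normal (Dx F s t) (Dy F s t)))).
  rewrite inversion_Dx, inversion_Dy by assumption.
  apply unit_normal_dinv; [now apply F_neq0|].
  exact (regular_e2l U F F_regular s t Hst).
Qed.

Lemma inversion_e2l (s t : R) : U s t ->
  e2l G s t = / dot (F s t) (F s t) ^ 2 * e2l F s t.
Proof.
  intros Hst; unfold e2l; rewrite inversion_Dx by assumption.
  now apply dot_dinv_dinv, F_neq0.
Qed.

Lemma inversion_sff_eps (s t : R) : U s t ->
  sff_eps G s t = - (dot (F s t) (F s t) * sff_eps F s t
                     + 2 * dot (normal F s t) (F s t)).
Proof.
  intros Hst.
  assert (He := regular_e2l U F F_regular s t Hst).
  assert (Hp := F_neq0 s t Hst).
  unfold sff_eps.
  rewrite (Dx_unique _ _ _ _ (inversion_is_derive_xx s t Hst)).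
  rewrite inversion_normal, inversion_e2l by assumption.
  rewrite dot_second_derivative_inversion;
    [|assumption|exact (dot_normal_l _ _)|exact (dot_normal_l _ _)].
  change (dot (Dx F s t) (Dx F s t)) with (e2l F s t).
  field; split; assumption.
Qed.

Lemma inversion_sff_phi (s t : R) : U s t ->
  sff_phi G s t = - (dot (F s t) (F s t) * sff_phi F s t).
Proof.
  intros Hst.
  assert (He := regular_e2l U F F_regular s t Hst).
  assert (Hp := F_neq0 s t Hst).
  unfold sff_phi.
  rewrite (Dy_unique _ _ _ _ (inversion_is_derive_xy s t Hst)).
  rewrite inversion_normal, inversion_e2l by assumption.
  rewrite dot_second_derivative_inversion;
    [|assumption|exact (dot_normal_l _ _)|exact (dot_normal_r _ _)].
  rewrite (proj1 (proj2 (reg_frame U F F_regular s t Hst))).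
  field; split; assumption.
Qed.

Lemma inversion_sff_gam (s t : R) : U s t ->
  sff_gam G s t = - (dot (F s t) (F s t) * sff_gam F s t
                     + 2 * dot (normal F s t) (F s t)).
Proof.
  intros Hst.
  assert (He := regular_e2l U F F_regular s t Hst).
  assert (Hp := F_neq0 s t Hst).
  unfold sff_gam.
  rewrite (Dy_unique _ _ _ _ (inversion_is_derive_yy s t Hst)).
  rewrite inversion_normal, inversion_e2l by assumption.
  rewrite dot_second_derivative_inversion;
    [|assumption|exact (dot_normal_r _ _)|exact (dot_normal_r _ _)].
  rewrite <- (proj1 (reg_frame U F F_regular s t Hst)).
  change (dot (Dx F s t) (Dx F s t)) with (e2l F s t).
  field; split; assumption.
Qed.

Lemma inversion_meanH (s t : R) : U s t ->
  meanH G s t = - (dot (F s t) (F s t) * meanH F s t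
                   + 2 * dot (normal F s t) (F s t)).
Proof.
  intros Hst.
  rewrite (meanH_eq F) by exact (regular_e2l U F F_regular s t Hst).
  rewrite (meanH_eq G).
  - rewrite inversion_sff_eps, inversion_sff_gam by assumption; field.
  - destruct (inversion_frame s t Hst) as (_ & _ & H); unfold e2l; lra.
Qed.

(** The shift 2 <n, F> is the same in both diagonal entries and drops out of eps - gam. What remains
    is scaled by -|F|^2, which meets the factor 1 / |F|^2 of [dinv]. *)
Lemma inversion_Aring (s t : R) : U s t ->
  fst (Aring_grad G s t) = opp (reflection (F s t) (fst (Aring_grad F s t))) /\ 
  snd (Aring_grad G s t) = opp (reflection (F s t) (snd (Aring_grad F s t))).
Proof.
  intros Hst; assert (Hp := F_neq0 s t Hst).
  unfold Aring_grad; cbn [fst snd].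
  rewrite inversion_sff_eps, inversion_sff_gam, inversion_sff_phi,
    inversion_Dx, inversion_Dy by assumption.
  generalize (sff_eps F s t) (sff_gam F s t) (sff_phi F s t)
    (dot (normal F s t) (F s t)) (Dx F s t) (Dy F s t).
  intros e g f c X Y; unfold dinv, reflection.
  rewrite dot_plus_l, dot_minus_l, !dot_scal_l.
  generalize dependent (dot (F s t) (F s t)).
  generalize (dot X (F s t)) (dot Y (F s t)).
  intros; split; vec ltac:(field; assumption).
Qed.

(** Differentiating |F|^2 H + 2 <n, F>, the term 2 <F_x, F> H cancels against the trace part of 2
    <n_x, F>, and <n, F_x> = 0; only A remains beside the derivative of H. *)
Lemma inversion_is_derive_meanH_x (s t : R) : U s t ->
  is_derive (fun s' => meanH G s' t) s
    (- (dot (F s t) (F s t) * Derive (fun s' => meanH F s' t) s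
        - 2 * dot (fst (Aring_grad F s t)) (F s t))).
Proof.
  intros Hst.
  assert (Hp := reg_x U F F_regular s t Hst).
  assert (HH : is_derive (fun s' : R => meanH F s' t) s
    (Derive (fun s' : R => meanH F s' t) s))
    by exact (Derive_correct _ _ (reg_Hx U F F_regular s t Hst)).
  assert (Hn := is_derive3_normal_x U F U_open F_regular s t Hst).
  assert (Hnp := is_derive_dot _ _ _ _ _ Hn Hp).
  assert (Hpp := is_derive_dot _ _ _ _ _ Hp Hp).
  apply (is_derive_ext_loc (fun s' => - (dot (F s' t) (F s' t) * meanH F s' t
    + 2 * dot (normal F s' t) (F s' t)))).
  { eapply filter_imp; [|exact (proj1 (U_open s t Hst))].
    intros s' Hs'; symmetry; exact (inversion_meanH s' t Hs'). }
  eapply is_derive_eq.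
  { exact (is_derive_Ropp _ _ _
      (is_derive_Rplus _ _ _ _ _ (is_derive_Rmult _ _ _ _ _ Hpp HH)
        (is_derive_scal _ _ 2 _ Hnp))). }
  cbv beta.
  replace (dot (normal F s t) (Dx F s t)) with 0
    by (symmetry; exact (dot_normal_l _ _)).
  rewrite dot_opp_l, dot_plus_l, dot_scal_l, (dot_comm (F s t) (Dx F s t)).
  ring.
Qed.

Lemma inversion_is_derive_meanH_y (s t : R) : U s t ->
  is_derive (fun t' => meanH G s t') t
    (- (dot (F s t) (F s t) * Derive (fun t' => meanH F s t') t
        - 2 * dot (snd (Aring_grad F s t)) (F s t))).
Proof.
  intros Hst.
  assert (Hp := reg_y U F F_regular s t Hst).
  assert (HH : is_derive (fun t' : R => meanH F s t') t
    (Derive (fun t' : R => meanH F s t') t))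
    by exact (Derive_correct _ _ (reg_Hy U F F_regular s t Hst)).
  assert (Hn := is_derive3_normal_y U F U_open F_regular s t Hst).
  assert (Hnp := is_derive_dot _ _ _ _ _ Hn Hp).
  assert (Hpp := is_derive_dot _ _ _ _ _ Hp Hp).
  apply (is_derive_ext_loc (fun t' => - (dot (F s t') (F s t') * meanH F s t'
    + 2 * dot (normal F s t') (F s t')))).
  { eapply filter_imp; [|exact (proj2 (U_open s t Hst))].
    intros t' Ht'; symmetry; exact (inversion_meanH s t' Ht'). }
  eapply is_derive_eq.
  { exact (is_derive_Ropp _ _ _
      (is_derive_Rplus _ _ _ _ _ (is_derive_Rmult _ _ _ _ _ Hpp HH)
        (is_derive_scal _ _ 2 _ Hnp))). }
  cbv beta.
  replace (dot (normal F s t) (Dy F s t)) with 0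
    by (symmetry; exact (dot_normal_r _ _)).
  rewrite dot_opp_l, dot_plus_l, dot_scal_l, (dot_comm (F s t) (Dy F s t)).
  ring.
Qed.

End Inversion.

Lemma inversion_regular (U : R -> R -> Prop) (F : R -> R -> R3) :
  line_open U -> regular U F ->
  (forall s t, U s t -> dot (F s t) (F s t) <> 0) ->
  regular U (fun s t => inversion0 (F s t)).
Proof.
  intros HU HF HF0.
  split; intros s t Hst.
  - rewrite (inversion_Dx U F HF HF0) by assumption.
    now apply (inversion_is_derive_x U F HF HF0).
  - rewrite (inversion_Dy U F HF HF0) by assumption.
    now apply (inversion_is_derive_y U F HF HF0).
  - assert (H := inversion_is_derive_xx U F HU HF HF0 s t Hst).
    now rewrite (Dx_unique _ _ _ _ H).
  - assert (H := inversion_is_derive_xy U F HU HF HF0 s t Hst).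
    now rewrite (Dy_unique _ _ _ _ H).
  - rewrite (Dy_unique _ _ _ _ (inversion_is_derive_xy U F HU HF HF0 s t Hst)).
    now apply (inversion_is_derive_yx U F HU HF HF0).
  - assert (H := inversion_is_derive_yy U F HU HF HF0 s t Hst).
    now rewrite (Dy_unique _ _ _ _ H).
  - now apply (inversion_frame U F HF HF0).
  - eexists; now apply (inversion_is_derive_meanH_x U F HU HF HF0).
  - eexists; now apply (inversion_is_derive_meanH_y U F HU HF HF0).
Qed.

(** * Pointwise algebra and the laws for regular maps *)

(** One component of [Vinv], up to conversion: p is the position, V a component of [Vtra], and m
    that of the cross product of the normal with [Aring_grad]. *)
Definition inv_transform (p V m : R3) : R3 :=
  plus (minus (scal (dot p p) V) (scal 2 (scal (dot V p) p))) (scal 4 (cross p m)).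

(* [cross p (cross n a) = <p, a> n - <p, n> a]; the terms along [p] cancel. *)
Lemma inv_transform_tra (p n a : R3) (k h : R) : dot p p <> 0 ->
  inv_transform p (scal (-2) (plus (scal k n) (scal h a))) (cross n a) =
  scal (-2)
    (plus (scal (- (dot p p * k - 2 * dot a p)) (opp (reflection p n)))
          (scal (- (dot p p * h + 2 * dot n p)) (opp (reflection p a)))).
Proof.
  intros Hp; unfold inv_transform.
  replace (cross p (cross n a)) with (minus (scal (dot a p) n) (scal (dot n p) a))
    by vec ltac:(ring).
  unfold reflection; rewrite dot_scal_l, dot_plus_l, !dot_scal_l.
  generalize dependent (dot p p); generalize (dot a p) (dot n p).
  intros; vec ltac:(field; assumption).
Qed.

(** The first two terms of [inv_transform] make up |p|^2 R V, and R reverses the part of V along p;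
    [cross p m] is orthogonal to p. *)
Lemma inv_transform_dil (p V m : R3) : dot p p <> 0 ->
  dot (inv_transform p V m) (inversion0 p) = - dot V p.
Proof.
  intros Hp; unfold inv_transform, inversion0.
  rewrite dot_scal_r, dot_plus_l, dot_minus_l, !dot_scal_l, dot_cross_l.
  field; assumption.
Qed.

(** V and R V differ by a multiple of p, hence have the same cross product with p. The double
    product with m gives -4 times the part of m orthogonal to p, and twice that part is m + R m. *)
Lemma inv_transform_rot (p V m : R3) : dot p p <> 0 ->
  cross (inversion0 p) (inv_transform p V m) =
  minus (minus (cross p V) (scal 2 m)) (scal 2 (reflection p m)).
Proof.
  intros Hp; unfold inv_transform, inversion0, reflection.
  generalize (dot V p); intros c.
  transitivity (plus (cross p V)
    (scal (4 / dot p p) (minus (scal (dot m p) p) (scal (dot p p) m)))).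
  - replace (minus (scal (dot m p) p) (scal (dot p p) m)) with (cross p (cross p m))
      by vec ltac:(ring).
    generalize dependent (dot p p).
    intros; vec ltac:(field; assumption).
  - generalize dependent (dot p p); generalize (dot m p).
    intros; vec ltac:(field; assumption).
Qed.

Lemma reflection_opp (p v : R3) : reflection p (opp v) = opp (reflection p v).
Proof. unfold reflection; rewrite dot_opp_l; vec ltac:(unfold Rdiv; ring). Qed.

Section Conserved.

Variables (U : R -> R -> Prop) (F : R -> R -> R3).
Hypotheses (U_open : line_open U) (F_regular : regular U F).
Hypothesis F_neq0 : forall s t, U s t -> dot (F s t) (F s t) <> 0.
Variables x y : R.
Hypothesis Uxy : U x y.

Let G := fun s t => inversion0 (F s t).

Let G_regular : regular U G.
Proof. now apply inversion_regular. Qed.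

Lemma Vtra_inversion : Vtra G x y = Vinv F x y.
Proof.
  assert (Hp := F_neq0 x y Uxy).
  destruct (inversion_Aring U F U_open F_regular F_neq0 x y Uxy) as [HA1 HA2].
  apply injective_projections.
  - rewrite (Vtra_x U G U_open G_regular x y Uxy).
    assert (HG := is_derive_unique _ _ _
        (inversion_is_derive_meanH_x U F U_open F_regular F_neq0 x y Uxy)
      : Derive (fun s : R => meanH G s y) x = _).
    rewrite HG.
    fold G in HA1; rewrite HA1; unfold G.
    rewrite (inversion_meanH U F U_open F_regular F_neq0 x y Uxy).
    rewrite (inversion_normal U F F_regular F_neq0 x y Uxy).
    rewrite <- inv_transform_tra by assumption.
    rewrite <- (Vtra_x U F U_open F_regular x y Uxy).
    reflexivity.
  - rewrite (Vtra_y U G U_open G_regular x y Uxy).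
    assert (HG := is_derive_unique _ _ _
        (inversion_is_derive_meanH_y U F U_open F_regular F_neq0 x y Uxy)
      : Derive (fun t : R => meanH G x t) y = _).
    rewrite HG.
    fold G in HA2; rewrite HA2; unfold G.
    rewrite (inversion_meanH U F U_open F_regular F_neq0 x y Uxy).
    rewrite (inversion_normal U F F_regular F_neq0 x y Uxy).
    rewrite <- inv_transform_tra by assumption.
    rewrite <- (Vtra_y U F U_open F_regular x y Uxy).
    reflexivity.
Qed.

Lemma Vdil_inversion : Vdil G x y = opp (Vdil F x y).
Proof.
  assert (Hp := F_neq0 x y Uxy).
  unfold Vdil; rewrite Vtra_inversion.
  apply injective_projections; exact (inv_transform_dil _ _ _ Hp).
Qed.

(** The correction 2 [gradperp] n removes the trace: by Weingarten and the quarter turn, it adds up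
    with 2 H [gradperp] F to -2 m, where m = n x A. Inversion turns this into 2 R m, while
    [inv_transform_rot] contributes -2 m - 2 R m beside [cross p V]; the sum is again [cross p V] -
    2 m. *)
Lemma Vrot_tilde_inversion : Vrot_tilde G x y = Vrot_tilde F x y.
Proof.
  assert (Hp := F_neq0 x y Uxy).
  destruct (inversion_Aring U F U_open F_regular F_neq0 x y Uxy) as [HA1 HA2].
  fold G in HA1, HA2.
  destruct (cross_normal_Aring U F F_regular x y Uxy) as [HC1 HC2].
  unfold Vrot_tilde, Vrot; rewrite Vtra_inversion.
  apply injective_projections.
  - change (plus (plus (cross (inversion0 (F x y))
        (inv_transform (F x y) (fst (Vtra F x y))
          (cross (normal F x y) (fst (Aring_grad F x y)))))
        (scal (2 * meanH G x y) (opp (Dy G x y))))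
      (scal 2 (opp (Dy (normal G) x y))) =
      plus (plus (cross (F x y) (fst (Vtra F x y)))
        (scal (2 * meanH F x y) (opp (Dy F x y))))
      (scal 2 (opp (Dy (normal F) x y)))).
    rewrite inv_transform_rot, HC1, reflection_opp by assumption.
    rewrite (Dy_unique _ _ _ _
      (is_derive3_normal_y U G U_open G_regular x y Uxy)), HA2.
    rewrite (Dy_unique _ _ _ _
      (is_derive3_normal_y U F U_open F_regular x y Uxy)).
    generalize (cross (F x y) (fst (Vtra F x y))).
    intros; vec ltac:(ring).
  - change (plus (plus (cross (inversion0 (F x y))
        (inv_transform (F x y) (snd (Vtra F x y))
          (cross (normal F x y) (snd (Aring_grad F x y)))))
        (scal (2 * meanH G x y) (Dx G x y)))
      (scal 2 (Dx (normal G) x y)) =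
      plus (plus (cross (F x y) (snd (Vtra F x y)))
        (scal (2 * meanH F x y) (Dx F x y)))
      (scal 2 (Dx (normal F) x y))).
    rewrite inv_transform_rot, HC2 by assumption.
    rewrite (Dx_unique _ _ _ _
      (is_derive3_normal_x U G U_open G_regular x y Uxy)), HA1.
    rewrite (Dx_unique _ _ _ _
      (is_derive3_normal_x U F U_open F_regular x y Uxy)).
    generalize (cross (F x y) (snd (Vtra F x y))).
    intros; vec ltac:(ring).
Qed.

End Conserved.

(** * Smooth conformal immersions of the disk *)

Lemma smooth_Dx (F : R -> R -> R3) : smooth F -> smooth (Dx F).
Proof.
  intros HF s t Hst n.
  destruct (HF s t Hst (S n)) as (H1 & H2 & H3).
  destruct H1 as (_ & _ & _ & H1 & _), H2 as (_ & _ & _ & H2 & _),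
    H3 as (_ & _ & _ & H3 & _).
  split; [exact H1|split; [exact H2|exact H3]].
Qed.

Lemma smooth_Dy (F : R -> R -> R3) : smooth F -> smooth (Dy F).
Proof.
  intros HF s t Hst n.
  destruct (HF s t Hst (S n)) as (H1 & H2 & H3).
  destruct H1 as (_ & _ & _ & _ & H1), H2 as (_ & _ & _ & _ & H2),
    H3 as (_ & _ & _ & _ & H3).
  split; [exact H1|split; [exact H2|exact H3]].
Qed.

Lemma smooth_is_derive_x (F : R -> R -> R3) (s t : R) :
  smooth F -> in_disk s t -> is_derive3 (fun s' => F s' t) s (Dx F s t).
Proof.
  intros HF Hst; destruct (HF s t Hst 1%nat) as (H1 & H2 & H3).
  destruct H1 as (_ & H1 & _), H2 as (_ & H2 & _), H3 as (_ & H3 & _).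
  split; [|split]; apply Derive_correct; assumption.
Qed.

Lemma smooth_is_derive_y (F : R -> R -> R3) (s t : R) :
  smooth F -> in_disk s t -> is_derive3 (fun t' => F s t') t (Dy F s t).
Proof.
  intros HF Hst; destruct (HF s t Hst 1%nat) as (H1 & H2 & H3).
  destruct H1 as (_ & _ & H1 & _), H2 as (_ & _ & H2 & _), H3 as (_ & _ & H3 & _).
  split; [|split]; apply Derive_correct; assumption.
Qed.

Lemma in_disk_open_2d (x y : R) : in_disk x y -> locally_2d in_disk x y.
Proof.
  intros Hxy; unfold in_disk in Hxy.
  assert (Hc : continuity_2d_pt (fun u v => u * u + v * v) x y).
  { apply continuity_2d_pt_plus; apply continuity_2d_pt_mult;
      first [apply continuity_2d_pt_id1 | apply continuity_2d_pt_id2]. }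
  assert (He : 0 < 1 - (x ^ 2 + y ^ 2)) by lra.
  destruct (Hc (mkposreal _ He)) as [d Hd]; exists d.
  intros u v Hu Hv; specialize (Hd u v Hu Hv); cbn [pos] in Hd.
  apply Rabs_def2 in Hd; unfold in_disk; lra.
Qed.

(** Schwarz's theorem in each coordinate; [ex_diff_n] at order 2 supplies the mixed derivatives
    nearby and their continuity at the point. *)
Lemma Dx_Dy_comm (F : R -> R -> R3) (x y : R) :
  smooth F -> in_disk x y -> Dx (Dy F) x y = Dy (Dx F) x y.
Proof.
  intros HF Hxy.
  assert (Hc : forall f : R -> R -> R,
    (forall s t, in_disk s t -> ex_diff_n f 2 s t) ->
    dx (dy f) x y = dy (dx f) x y).
  { intros f Hf; apply Schwarz.
    - eapply locally_2d_impl; [|exact (in_disk_open_2d x y Hxy)].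
      apply locally_2d_forall; intros u v Huv.
      destruct (Hf u v Huv) as (_ & H1 & H2 & (_ & _ & H3 & _) & (_ & H4 & _)).
      repeat split; assumption.
    - destruct (Hf x y Hxy) as (_ & _ & _ & _ & (_ & _ & _ & (H & _) & _)); exact H.
    - destruct (Hf x y Hxy) as (_ & _ & _ & (_ & _ & _ & _ & (H & _)) & _); exact H. }
  apply R3_eq; apply Hc; intros s t Hst; apply (HF s t Hst 2%nat).
Qed.

Lemma ex_derive_pos_locally (f : R -> R) (t c : R) :
  ex_derive f t -> c < f t -> locally t (fun s => c < f s).
Proof.
  intros Hf Ht.
  exact (ex_derive_continuous f t Hf _ (open_gt c (f t) Ht)).
Qed.

(** The right side of [meanH_eq] along a line, unfolded: a, b, c, d stand for the derivatives F_x,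
    F_y, F_xx, F_yy, so their derivatives bring in the third order. *)
Lemma ex_derive_meanH (a b c d : R -> R3) (t : R) (a' b' c' d' : R3) :
  is_derive3 a t a' -> is_derive3 b t b' -> is_derive3 c t c' -> is_derive3 d t d' ->
  dot (a t) (a t) <> 0 ->
  ex_derive (fun s =>
    (/ dot (a s) (a s) * dot (c s) (unit_normal (a s) (b s)) +
     / dot (a s) (a s) * dot (d s) (unit_normal (a s) (b s))) / 2) t.
Proof.
  intros Ha Hb Hc Hd H0.
  assert (Hn := is_derive3_unit_normal a b t a' b' Ha Hb H0).
  assert (He := is_derive_inv _ _ _ (is_derive_dot _ _ _ _ _ Ha Ha) H0).
  eexists.
  exact (is_derive_Rmult _ (fun _ => / 2) _ _ _
    (is_derive_Rplus _ _ _ _ _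
      (is_derive_Rmult _ _ _ _ _ He (is_derive_dot _ _ _ _ _ Hc Hn))
      (is_derive_Rmult _ _ _ _ _ He (is_derive_dot _ _ _ _ _ Hd Hn)))
    (is_derive_const (V := R_NormedModule) (/ 2) t)).
Qed.

Section Disk.

Variable Phi : R -> R -> R3.
Hypotheses (Phi_smooth : smooth Phi) (Phi_immersive : immersive Phi)
  (Phi_conformal : conformal Phi).

(** Nonvanishing is put as a strict inequality, to which [ex_derive_pos_locally] applies. *)
Let U := fun s t => in_disk s t /\ 0 < dot (Phi s t) (Phi s t).

Lemma line_open_nonzero : line_open U.
Proof.
  intros s t [Hst Hp]; split; apply filter_and.
  (* The inequality of the disk is negated because [ex_derive_pos_locally] handles lower bounds. *)
  - assert (H : locally s (fun s' => - 1 < - (s' ^ 2 + t ^ 2))).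
    { apply ex_derive_pos_locally;
        [auto_derive; trivial|unfold in_disk in Hst; lra]. }
    eapply filter_imp; [|exact H]; unfold in_disk; intros s'; cbv beta; lra.
  - apply ex_derive_pos_locally; [|exact Hp].
    assert (H := smooth_is_derive_x Phi s t Phi_smooth Hst).
    eexists; exact (is_derive_dot _ _ _ _ _ H H).
  - assert (H : locally t (fun t' => - 1 < - (s ^ 2 + t' ^ 2))).
    { apply ex_derive_pos_locally;
        [auto_derive; trivial|unfold in_disk in Hst; lra]. }
    eapply filter_imp; [|exact H]; unfold in_disk; intros t'; cbv beta; lra.
  - apply ex_derive_pos_locally; [|exact Hp].
    assert (H := smooth_is_derive_y Phi s t Phi_smooth Hst).
    eexists; exact (is_derive_dot _ _ _ _ _ H H).
Qed.

Lemma immersion_frame (s t : R) :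
  in_disk s t -> conformal_frame (Dx Phi s t) (Dy Phi s t).
Proof.
  intros Hst; destruct (Phi_conformal s t Hst) as [H1 H2].
  split; [exact H1|split; [exact H2|]].
  apply dot_self_pos; intros H0.
  destruct (Phi_immersive s t Hst 1 0) as [H _]; [|lra].
  rewrite H0; apply R3_eq; coords; unfold p1, p2, p3; cbn; ring.
Qed.

Lemma immersion_e2l (s t : R) : in_disk s t -> e2l Phi s t <> 0.
Proof.
  intros Hst; destruct (immersion_frame s t Hst) as (_ & _ & H); unfold e2l; lra.
Qed.

Lemma immersion_regular : regular U Phi.
Proof.
  assert (Hx := smooth_Dx _ Phi_smooth); assert (Hy := smooth_Dy _ Phi_smooth).
  assert (Hxx := smooth_Dx _ Hx); assert (Hyy := smooth_Dy _ Hy).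
  split; intros s t Hst; assert (Hd := proj1 Hst).
  - now apply smooth_is_derive_x.
  - now apply smooth_is_derive_y.
  - now apply smooth_is_derive_x.
  - now apply smooth_is_derive_y.
  - rewrite <- Dx_Dy_comm by assumption; now apply smooth_is_derive_x.
  - now apply smooth_is_derive_y.
  - now apply immersion_frame.
  - eapply ex_derive_ext_loc.
    2: exact (ex_derive_meanH _ _ _ _ _ _ _ _ _
         (smooth_is_derive_x _ s t Hx Hd) (smooth_is_derive_x _ s t Hy Hd)
         (smooth_is_derive_x _ s t Hxx Hd) (smooth_is_derive_x _ s t Hyy Hd)
         (immersion_e2l s t Hd)).
    eapply filter_imp; [|exact (proj1 (line_open_nonzero s t Hst))].
    intros s' [Hs' _]; symmetry; exact (meanH_eq Phi s' t (immersion_e2l s' t Hs')).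
  - eapply ex_derive_ext_loc.
    2: exact (ex_derive_meanH _ _ _ _ _ _ _ _ _
         (smooth_is_derive_y _ s t Hx Hd) (smooth_is_derive_y _ s t Hy Hd)
         (smooth_is_derive_y _ s t Hxx Hd) (smooth_is_derive_y _ s t Hyy Hd)
         (immersion_e2l s t Hd)).
    eapply filter_imp; [|exact (proj2 (line_open_nonzero s t Hst))].
    intros t' [Ht' _]; symmetry; exact (meanH_eq Phi s t' (immersion_e2l s t' Ht')).
Qed.

End Disk.

(** * Inverting twice, and the four laws on the disk *)

Lemma dot_inversion0_self (v : R3) :
  dot v v <> 0 -> dot (inversion0 v) (inversion0 v) = / dot v v.
Proof.
  intros Hv; unfold inversion0; rewrite dot_scal_l, dot_scal_r; field; assumption.
Qed.

(* At the origin this holds because [inversion0 zero = zero]. *)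
Lemma inversion0_involutive (v : R3) : inversion0 (inversion0 v) = v.
Proof.
  destruct (Req_dec (dot v v) 0) as [H0|H0].
  - assert (Hv : v = zero).
    { unfold dot in H0; apply R3_eq; unfold zero; cbn; nra. }
    rewrite Hv; unfold inversion0; vec ltac:(unfold p1, p2, p3, zero; cbn; ring).
  - unfold inversion0 at 1; rewrite dot_inversion0_self by assumption.
    unfold inversion0; rewrite Rinv_inv; vec ltac:(field; assumption).
Qed.

Theorem corollary1p1 (Phi : R -> R -> R3)
    (Phi_smooth : smooth Phi)
    (Phi_immersive : immersive Phi)
    (Phi_conformal : conformal Phi)
    (Phi_willmore : willmore Phi)
    (x y : R) (xy_disk : in_disk x y) (Phi_neq0 : Phi x y <> zero) :
  let iPhi := fun s t => inversion0 (Phi s t) in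
  Vtra iPhi x y = Vinv Phi x y /\
  Vinv iPhi x y = Vtra Phi x y /\
  Vdil iPhi x y = opp (Vdil Phi x y) /\
  Vrot_tilde iPhi x y = Vrot_tilde Phi x y.
Proof.
  intros iPhi.
  set (U := fun s t => in_disk s t /\ 0 < dot (Phi s t) (Phi s t)).
  assert (HU : line_open U) by now apply line_open_nonzero.
  assert (HPhi : regular U Phi) by now apply immersion_regular.
  assert (H0 : forall s t, U s t -> dot (Phi s t) (Phi s t) <> 0)
    by (intros s t [_ H]; lra).
  assert (Hxy : U x y) by (split; [assumption|now apply dot_self_pos]).
  assert (HiPhi : regular U iPhi) by now apply inversion_regular.
  assert (Hi0 : forall s t, U s t -> dot (iPhi s t) (iPhi s t) <> 0).
  { intros s t Hst; unfold iPhi.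
    rewrite dot_inversion0_self by now apply H0.
    now apply Rinv_neq_0_compat, H0. }
  (* An equality of maps on the whole plane, so that it can be rewritten under the derivatives; it
     therefore also covers the zeros of [Phi]. *)
  assert (Hii : (fun s t => inversion0 (iPhi s t)) = Phi).
  { apply functional_extensionality; intros s.
    apply functional_extensionality; intros t.
    apply inversion0_involutive. }
  split; [now apply (Vtra_inversion U)|].
  split; [|split].
  (* The law of [Vtra] for the inverted map, read from right to left. *)
  - rewrite <- (Vtra_inversion U iPhi) by assumption.
    now rewrite Hii.
  - now apply (Vdil_inversion U).
  - now apply (Vrot_tilde_inversion U).
Qed.
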